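(* There exists a constant $C>1$ such that the following holds. Let $r,\ell>1$ with $800C^2r^{1/3}<\ell<r^{2/3}$ and let $w\in(0,1)$. Suppose there is no rational number $a/q$ (with $q\ge1$) such that $q\le 800C^4r^{2/3}/\ell$ and $|w-a/q|\le 1/(q r^{1/3})$. Then there exists a curve $\Gamma\subset\mathbb R^2$ such that (i) $\Gamma$ is twice differentiable and its radius of curvature always lies in $[C^3r/32,\,32C^3r]$; (ii) the length of $\Gamma$ is less than $\ell$; (iii) the initial slope of $\Gamma$ is $w$; (iv) $|\Gamma\cap\mathbb Z^2|\ge \frac{1}{3200\pi^2C}\,\ell r^{-1/3}$. *)

(* Defs.v *)
From Stdlib Require Import Reals ZArith Ensembles Finite_sets.
From Coquelicot Require Import Coquelicot.
Open Scope R_scope.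

(* A parametrized plane curve t |-> (cx t, cy t), c_start <= t <= c_end; values
   of cx and cy outside this interval are irrelevant to everything below. *)
Record curve := Curve {
  cx : R -> R;
  cy : R -> R;
  c_start : R;
  c_end : R;
  c_start_lt_end : c_start < c_end
}.

Definition c_dom (G : curve) (t : R) : Prop := c_start G <= t <= c_end G.

(* [D_in] takes the difference quotient within the given domain, so
   derivatives at the two endpoints are one-sided. *)
Definition derivative_on (D : R -> Prop) (f df : R -> R) : Prop :=
  forall t, D t -> D_in f df D t.

(* Twice differentiability is asked of a regular parametrization (nowhere zero
   velocity): this is what makes it a property of the curve itself, equivalent
   to twice differentiability of its arc-length parametrization. *)
Record twice_differentiable (G : curve) := TwiceDifferentiable {
  dx : R -> R;
  dy : R -> R;
  ddx : R -> R;
  ddy : R -> R;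
  dxP : derivative_on (c_dom G) (cx G) dx;
  dyP : derivative_on (c_dom G) (cy G) dy;
  ddxP : derivative_on (c_dom G) dx ddx;
  ddyP : derivative_on (c_dom G) dy ddy;
  c_regular : forall t, c_dom G t -> dx t <> 0 \/ dy t <> 0
}.

Arguments dx {G} _ _.
Arguments dy {G} _ _.
Arguments ddx {G} _ _.
Arguments ddy {G} _ _.

Definition speed {G : curve} (J : twice_differentiable G) (t : R) : R :=
  sqrt (dx J t ^ 2 + dy J t ^ 2).

Definition curvature {G : curve} (J : twice_differentiable G) (t : R) : R :=
  Rabs (dx J t * ddy J t - dy J t * ddx J t) / speed J t ^ 3.

(* The radius of curvature is infinite where the curvature vanishes. *)
Definition is_radius_of_curvature {G : curve} (J : twice_differentiable G)
    (t rho : R) : Prop :=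
  curvature J t <> 0 /\ rho = / curvature J t.

Definition is_length {G : curve} (J : twice_differentiable G) (L : R) : Prop :=
  is_RInt (speed J) (c_start G) (c_end G) L.

Definition is_initial_slope {G : curve} (J : twice_differentiable G)
    (w : R) : Prop :=
  dx J (c_start G) <> 0 /\ w = dy J (c_start G) / dx J (c_start G).

(* The trace of G intersected with Z^2. *)
Definition lattice_points (G : curve) : Ensemble (Z * Z) :=
  fun p => exists t, c_dom G t /\ cx G t = IZR (fst p) /\ cy G t = IZR (snd p).

(* Main.v *)
Require Import Defs.
From Stdlib Require Import Reals ZArith Ensembles Finite_sets.
From Coquelicot Require Import Coquelicot.
From Stdlib Require Import Lra Lia List FinFun Finite_sets_facts.
Open Scope R_scope.

(** Let C = 64, S = C r^(1/3), T = S^3 = C^3 r and N = floor(S / 3), and let f_1 < f_2 < ... be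
    the Farey fractions of order N that follow w. The curve is a graph with second derivative
    about 1 / T, tangent to slope f_i at its i-th lattice point. Between the tangent directions
    (q, a) and (q', a') of two Farey neighbours, turning by 1 / (q q'), the chord is
    al (q, a) + be (q', a') with integers al, be chosen so that al q and be q' are both close to
    T / (2 q q'); the arc is then a small perturbation of a parabola. The total length is about
    T (f_n - w), so it remains to see that n Farey steps from w cover at most about n / N^2.
    Only gaps next to a denominator q <= N / 8 can be much longer than 1 / N^2. Such a gap is
    about 1 / (q N), and since two fractions differ by at least 1 / (q q'), these gaps occupy
    only a small proportion of the interval, the first one excepted; for that one the hypothesis
    on w is used. *)

(** * Farey fractions around w and their successors *)

(** Induction on the order [S n]: once [q + q'] no longer exceeds the order, the mediant is
    admissible and replaces the end lying on its side of [w]; the determinant stays 1. *)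
Lemma farey_pair (w : R) (n : nat) :
  exists a q a' q' : Z,
    (1 <= q <= Z.of_nat (S n))%Z /\ (1 <= q' <= Z.of_nat (S n))%Z /\
    (Z.of_nat (S n) < q + q')%Z /\ (a' * q - a * q' = 1)%Z /\
    IZR a <= w * IZR q /\ w * IZR q' < IZR a'.
Proof.
induction n as [|n IH].
- exists (Int_part w), 1%Z, (Int_part w + 1)%Z, 1%Z.
  destruct (base_Int_part w) as [H1 H2].
  rewrite plus_IZR; repeat split; try lia; lra.
- destruct IH as (a & q & a' & q' & Hq & Hq' & Hs & Hd & Hl & Hr).
  destruct (Z_lt_le_dec (Z.of_nat (S (S n))) (q + q')) as [H|H].
  + exists a, q, a', q'; repeat split; auto; lia.
  + destruct (Rle_lt_dec (IZR (a + a')) (w * IZR (q + q'))) as [Hm|Hm].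
    * exists (a + a')%Z, (q + q')%Z, a', q'; repeat split; auto; lia.
    * exists a, q, (a + a')%Z, (q + q')%Z; repeat split; auto; lia.
Qed.

(** Determinant 1 together with [N < q + q'] characterises neighbours in the Farey sequence of order
    [N]; pairs are (numerator, denominator). *)
Definition farey_pair_spec (N : Z) (s : (Z * Z) * (Z * Z)) : Prop :=
  let '((a, q), (a', q')) := s in
  (1 <= q <= N)%Z /\ (1 <= q' <= N)%Z /\ (N < q + q')%Z /\ (a' * q - a * q' = 1)%Z.

(** The classical recurrence: [k] is the largest integer with [k * q' - q <= N], so that
    [k * q' - q] also exceeds [N - q']. *)
Definition farey_next (N : Z) (s : (Z * Z) * (Z * Z)) : (Z * Z) * (Z * Z) :=
  let '((a, q), (a', q')) := s in
  let k := ((N + q) / q')%Z in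
  ((a', q'), (k * a' - a, k * q' - q)%Z).

Lemma farey_next_spec (N : Z) s :
  farey_pair_spec N s -> farey_pair_spec N (farey_next N s).
Proof.
destruct s as [[a q] [a' q']]; simpl; intros (Hq & Hq' & Hs & Hd).
pose proof (Z.div_mod (N + q) q' ltac:(lia)) as E.
pose proof (Z.mod_pos_bound (N + q) q' ltac:(lia)) as B.
set (k := ((N + q) / q')%Z) in *; clearbody k.
repeat split; nia.
Qed.

Lemma farey_seq (N : Z) (w : R) : (1 <= N)%Z ->
  exists a q : nat -> Z,
    (forall i, (1 <= q i <= N)%Z) /\ (forall i, (N < q i + q (S i))%Z) /\
    (forall i, (a (S i) * q i - a i * q (S i) = 1)%Z) /\
    IZR (a O) <= w * IZR (q O) /\ w * IZR (q 1%nat) < IZR (a 1%nat).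
Proof.
intros HN.
destruct (farey_pair w (Z.to_nat (N - 1))) as (a0 & q0 & a1 & q1 & H).
replace (Z.of_nat (S (Z.to_nat (N - 1)))) with N in H by lia.
destruct H as (H1 & H2 & H3 & H4 & H5 & H6).
pose (s := fun i => Nat.iter i (farey_next N) ((a0, q0), (a1, q1))).
assert (Hs : forall i, farey_pair_spec N (s i)).
{ induction i as [|i IH]; [simpl; tauto|now apply farey_next_spec]. }
(* Consecutive states overlap in one fraction, so their first components form a single sequence. *)
assert (Hn : forall i, fst (s (S i)) = snd (s i)).
{ intros i; change (s (S i)) with (farey_next N (s i)).
  now destruct (s i) as [[? ?] [? ?]]. }
exists (fun i => fst (fst (s i))), (fun i => snd (fst (s i))).
assert (A : forall i, farey_pair_spec N (fst (s i), fst (s (S i)))).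
{ intros i; rewrite Hn; specialize (Hs i); now destruct (s i). }
split; [|split; [|split; [|split; [exact H5|exact H6]]]];
  intros i; specialize (A i); destruct (fst (s i)), (fst (s (S i))); simpl in *; tauto || lia.
Qed.

(** * How far n Farey steps from w can reach *)

Section FareySpread.
(** [Q] and [R0] stand for 800 C^4 r^(2/3) / l and r^(1/3) in the hypothesis on [w]. *)
Variables (N : Z) (w Q R0 : R) (a q : nat -> Z).
Hypothesis HN : (1 <= N)%Z.
Hypothesis Hq : forall i, (1 <= q i <= N)%Z.
Hypothesis Hs : forall i, (N < q i + q (S i))%Z.
Hypothesis Hd : forall i, (a (S i) * q i - a i * q (S i) = 1)%Z.
Hypothesis Hw0 : IZR (a O) <= w * IZR (q O).
Hypothesis Hw1 : w * IZR (q 1%nat) < IZR (a 1%nat).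
Hypothesis HQ : 0 < Q.
Hypothesis HR0 : 0 < R0 <= IZR N / 16.
Hypothesis Hirr : forall b d : Z, (1 <= d)%Z -> IZR d <= Q ->
  1 / (IZR d * R0) < Rabs (w - IZR b / IZR d).

Let fr i := IZR (a i) / IZR (q i).

Lemma farey_den_pos i : 1 <= IZR (q i).
Proof. apply IZR_le, Hq. Qed.

Lemma farey_den_sum i : IZR N < IZR (q i) + IZR (q (S i)).
Proof. rewrite <- plus_IZR; apply IZR_lt, Hs. Qed.

Lemma farey_gap i : fr (S i) - fr i = / (IZR (q i) * IZR (q (S i))).
Proof.
pose proof (farey_den_pos i); pose proof (farey_den_pos (S i)).
pose proof (Hd i) as D; apply (f_equal IZR) in D.
rewrite minus_IZR, !mult_IZR in D.
unfold fr; apply Rmult_eq_reg_r with (IZR (q i) * IZR (q (S i))); [|nra].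
field_simplify; lra.
Qed.

Lemma farey_lt i j : (i < j)%nat -> fr i < fr j.
Proof.
assert (H : forall i, fr i < fr (S i)).
{ intros k; pose proof (farey_gap k); pose proof (farey_den_pos k);
  pose proof (farey_den_pos (S k)).
  assert (0 < / (IZR (q k) * IZR (q (S k)))) by (apply Rinv_0_lt_compat; nra). lra. }
induction 1 as [|j Hj IH]; [apply H|]. pose proof (H j); lra.
Qed.

Lemma farey_le i j : (i <= j)%nat -> fr i <= fr j.
Proof.
intros H; destruct (proj1 (Nat.lt_eq_cases i j) H) as [L|L].
- left; now apply farey_lt.
- subst; lra.
Qed.

(** The difference of the two fractions is a positive integer over [q i * q j]. The factor [q i]
    stays on the right so that the bound on small denominators can be inserted there. *)
Lemma farey_spacing i j : (i < j)%nat -> / IZR (q j) <= IZR (q i) * (fr j - fr i).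
Proof.
intros H; pose proof (farey_lt i j H) as L.
pose proof (farey_den_pos i) as Hi; pose proof (farey_den_pos j) as Hj.
assert (E : (fr j - fr i) * (IZR (q i) * IZR (q j)) = IZR (a j * q i - a i * q j)).
{ rewrite minus_IZR, !mult_IZR; unfold fr; field; lra. }
assert (P : 0 < IZR (a j * q i - a i * q j)) by (rewrite <- E; apply Rmult_lt_0_compat; nra).
apply (lt_IZR 0) in P.
assert (P1 : 1 <= IZR (a j * q i - a i * q j)) by (apply IZR_le; lia).
apply Rmult_le_reg_r with (IZR (q j)); [lra|].
rewrite Rinv_l by lra. nra.
Qed.

Lemma farey_start_lt : w < fr 1.
Proof.
pose proof (farey_den_pos 1).
unfold fr; apply Rmult_lt_reg_r with (IZR (q 1%nat)); [lra|].
field_simplify; lra.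
Qed.

Lemma farey_start_le : fr 0 <= w.
Proof.
pose proof (farey_den_pos 0).
unfold fr; apply Rmult_le_reg_r with (IZR (q 0%nat)); [lra|].
field_simplify; lra.
Qed.

(** From index 1 on the fractions lie above [w], so the hypothesis becomes one-sided: an analogue of
    [farey_spacing] with [w] as the earlier fraction and [R0] as its denominator. *)
Lemma farey_irr i : (1 <= i)%nat -> IZR (q i) <= Q -> / IZR (q i) < R0 * (fr i - w).
Proof.
intros Hi Hle.
pose proof (Hirr (a i) (q i) (proj1 (Hq i)) Hle) as H.
pose proof (farey_le 1 i Hi); pose proof farey_start_lt.
pose proof (farey_den_pos i).
fold (fr i) in H; rewrite Rabs_left in H by lra.
apply Rmult_lt_compat_l with (r := R0) in H; [|lra].
replace (R0 * (1 / (IZR (q i) * R0))) with (/ IZR (q i)) in H by (field; lra). lra.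
Qed.

(** Both neighbours of [w] have denominators above [Q], and the larger one is at least N / 2. *)
Lemma farey_start_gap : fr 1 - w <= 2 / (Q * IZR N).
Proof.
pose proof (farey_gap 0) as G; pose proof farey_start_lt; pose proof farey_start_le.
pose proof (farey_den_pos 0); pose proof (farey_den_pos 1); pose proof (farey_den_sum 0).
(* At an end with denominator q at most [Q], the distance to [w] exceeds 1 / (q R0) but not the gap,
   which forces the other denominator below [R0]. *)
assert (B1 : IZR (q 1%nat) <= Q -> IZR (q O) < R0).
{ intros Hle; pose proof (farey_irr 1 ltac:(lia) Hle) as K.
  assert (/ IZR (q 1%nat) < R0 * / (IZR (q 0%nat) * IZR (q 1%nat))) as K' by nra.
  apply Rmult_lt_compat_l with (r := IZR (q 0%nat) * IZR (q 1%nat)) in K'; [|nra].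
  replace (IZR (q 0%nat) * IZR (q 1%nat) * / IZR (q 1%nat)) with (IZR (q 0%nat)) in K' by (field; lra).
  replace (IZR (q 0%nat) * IZR (q 1%nat) * (R0 * / (IZR (q 0%nat) * IZR (q 1%nat)))) with R0 in K' by (field; lra).
  lra. }
assert (B0 : IZR (q O) <= Q -> IZR (q 1%nat) < R0).
{ intros Hle; pose proof (Hirr (a O) (q O) (proj1 (Hq O)) Hle) as K.
  fold (fr O) in K; rewrite Rabs_pos_eq in K by lra.
  assert (1 / (IZR (q 0%nat) * R0) < / (IZR (q 0%nat) * IZR (q 1%nat))) as K' by lra.
  apply Rmult_lt_compat_l with (r := IZR (q 0%nat) * IZR (q 1%nat) * R0) in K';
    [|apply Rmult_lt_0_compat; nra].
  replace (IZR (q 0%nat) * IZR (q 1%nat) * R0 * (1 / (IZR (q 0%nat) * R0))) with (IZR (q 1%nat)) in K' by (field; lra).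
  replace (IZR (q 0%nat) * IZR (q 1%nat) * R0 * / (IZR (q 0%nat) * IZR (q 1%nat))) with R0 in K' by (field; lra).
  lra. }
(* If [q 0] is at most [Q], then [q 1] is below [R0 <= N / 16], so [q 0] is above 15 N / 16 and
   [q 1] is at most [Q] too. Hence [q 0] is also below [R0], a contradiction. *)
assert (C0 : Q < IZR (q O)).
{ apply Rnot_le_lt; intros Hle; specialize (B0 Hle).
  apply (Rlt_irrefl (IZR (q O))), Rlt_le_trans with R0; [apply B1|]; lra. }
assert (C1 : Q < IZR (q 1%nat)).
{ apply Rnot_le_lt; intros Hle; specialize (B1 Hle).
  apply (Rlt_irrefl (IZR (q 1%nat))), Rlt_le_trans with R0; [apply B0|]; lra. }
assert (N1 : 1 <= IZR N) by now apply IZR_le.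
apply Rle_trans with (/ (IZR (q 0%nat) * IZR (q 1%nat))); [lra|].
replace (2 / (Q * IZR N)) with (/ (Q * IZR N / 2)) by (field; lra).
apply Rinv_le_contravar; [nra|].
destruct (Rle_lt_dec (IZR N / 2) (IZR (q O))); nra.
Qed.

(** The neighbours of a small denominator exceed 7 N / 8, so each gap beside it is at most 8 / (7 N)
    times this weight. *)
Definition small_den_weight i : R :=
  if Z_le_dec (8 * q i) N then / IZR (q i) else 0.

Fixpoint small_den_sum n : R :=
  match n with
  | O => 0
  | S m => small_den_sum m + small_den_weight (S m)
  end.

(* By spacing, each new term 1 / q_j is paid for by the distance from the previous small
   denominator; the first one is paid for by the hypothesis on w. *)
Lemma small_den_sum_bound_last n :
  small_den_sum n = 0 \/
  exists k, (1 <= k <= n)%nat /\ (8 * q k <= N)%Z /\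
    small_den_sum n <= / Q + (IZR N / 8 + R0) * (fr k - w).
Proof.
assert (N1 : 1 <= IZR N) by now apply IZR_le.
assert (Qi : 0 < / Q) by now apply Rinv_0_lt_compat.
induction n as [|n IH]; [now left|].
simpl; unfold small_den_weight; destruct (Z_le_dec (8 * q (S n)) N) as [Hb|Hb].
(* [k] is the index of the last small denominator met so far. *)
- right; exists (S n); split; [lia|split; [exact Hb|]].
  destruct IH as [E|(k & Hk & Hbk & Hle)].
  + rewrite E, Rplus_0_l.
    pose proof farey_start_lt; pose proof (farey_le 1 (S n) ltac:(lia)).
    destruct (Rle_lt_dec (IZR (q (S n))) Q) as [L|L].
    * pose proof (farey_irr (S n) ltac:(lia) L); nra.
    * assert (/ IZR (q (S n)) <= / Q) by (apply Rinv_le_contravar; lra). nra.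
  + pose proof (farey_spacing k (S n) ltac:(lia)) as L.
    pose proof (farey_lt k (S n) ltac:(lia)).
    apply IZR_le in Hbk; rewrite mult_IZR in Hbk. nra.
- rewrite Rplus_0_r; destruct IH as [E|(k & Hk & Hbk & Hle)]; [now left|].
  right; exists k; repeat split; auto; lia.
Qed.

Lemma small_den_sum_bound n : (1 <= n)%nat ->
  small_den_sum n <= / Q + 3 * IZR N / 16 * (fr n - w).
Proof.
intros Hn.
assert (N1 : 1 <= IZR N) by now apply IZR_le.
assert (Qi : 0 < / Q) by now apply Rinv_0_lt_compat.
pose proof farey_start_lt; pose proof (farey_le 1 n Hn).
destruct (small_den_sum_bound_last n) as [E|(k & Hk & _ & Hle)].
- rewrite E; nra.
- pose proof (farey_le k n ltac:(lia)); pose proof (farey_le 1 k ltac:(lia)). nra.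
Qed.

(** If neither denominator is small, one is at least N / 2 and the other above N / 8, so their
    product exceeds N^2 / 16. Otherwise the gap is paid for by a weight. *)
Lemma farey_gap_bound i :
  fr (S i) - fr i <= 16 / IZR N ^ 2 +
    8 / (7 * IZR N) * (small_den_weight i + small_den_weight (S i)).
Proof.
assert (N1 : 1 <= IZR N) by now apply IZR_le.
pose proof (farey_den_pos i) as H0; pose proof (farey_den_pos (S i)) as H1.
pose proof (farey_den_sum i) as H2.
rewrite farey_gap.
assert (P : 0 <= 16 / IZR N ^ 2) by (apply Rle_mult_inv_pos; nra).
assert (P' : 0 <= 8 / (7 * IZR N)) by (apply Rle_mult_inv_pos; nra).
assert (W : forall j, 0 <= small_den_weight j).
{ intros j; unfold small_den_weight; destruct Z_le_dec; [|lra].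
  left; apply Rinv_0_lt_compat; pose proof (farey_den_pos j); lra. }
pose proof (W i) as W0; pose proof (W (S i)) as W1.
unfold small_den_weight in *.
destruct (Z_le_dec (8 * q i) N) as [B|B].
- apply Rle_trans with (8 / (7 * IZR N) * / IZR (q i)); [|nra].
  replace (8 / (7 * IZR N) * / IZR (q i)) with (/ (IZR (q i) * (7 * IZR N / 8))) by (field; lra).
  apply IZR_le in B; rewrite mult_IZR in B. apply Rinv_le_contravar; nra.
- destruct (Z_le_dec (8 * q (S i)) N) as [B'|B'].
  + apply Rle_trans with (8 / (7 * IZR N) * / IZR (q (S i))); [|nra].
    replace (8 / (7 * IZR N) * / IZR (q (S i))) with (/ ((7 * IZR N / 8) * IZR (q (S i)))) by (field; lra).
    apply IZR_le in B'; rewrite mult_IZR in B'. apply Rinv_le_contravar; nra.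
  + apply Rle_trans with (16 / IZR N ^ 2); [|nra].
    replace (16 / IZR N ^ 2) with (/ (IZR N ^ 2 / 16)) by (field; lra).
    assert (C : IZR N < 8 * IZR (q i)) by (rewrite <- mult_IZR; apply IZR_lt; lia).
    assert (C' : IZR N < 8 * IZR (q (S i))) by (rewrite <- mult_IZR; apply IZR_lt; lia).
    apply Rinv_le_contravar; [nra|].
    destruct (Rle_lt_dec (IZR N / 2) (IZR (q i))); nra.
Qed.

(** A weight enters through the gaps on both of its sides, but the last one only through the gap on
    its left. The same saving at index 1 is given away. *)
Lemma farey_spread_sum n :
  fr (S n) - fr 1 <= 16 * INR n / IZR N ^ 2 +
    8 / (7 * IZR N) * (2 * small_den_sum (S n) - small_den_weight (S n)).
Proof.
assert (N1 : 1 <= IZR N) by now apply IZR_le.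
induction n as [|n IH].
- simpl. ring_simplify.
  assert (0 <= small_den_weight 1).
  { unfold small_den_weight; destruct Z_le_dec; [|lra].
    left; apply Rinv_0_lt_compat; pose proof (farey_den_pos 1); lra. }
  assert (P' : 0 <= 8 / (7 * IZR N)) by (apply Rle_mult_inv_pos; nra).
  unfold Rdiv in *. nra.
- pose proof (farey_gap_bound (S n)) as G.
  change (small_den_sum (S (S n))) with (small_den_sum (S n) + small_den_weight (S (S n))).
  rewrite (S_INR n).
  replace (16 * (INR n + 1) / IZR N ^ 2) with (16 * INR n / IZR N ^ 2 + 16 / IZR N ^ 2) by (field; lra).
  lra.
Qed.

(** The weights contribute 2 * 8 / (7 N) * 3 N / 16 = 3/7 of the spread itself, which is absorbed on
    the left. Dividing by 4/7 turns 16 into 28, and 16/7 + 2 into 15/2, below 8. *)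
Lemma farey_spread n : (1 <= n)%nat ->
  fr n - w <= 28 * INR n / IZR N ^ 2 + 8 / (Q * IZR N).
Proof.
intros Hn; destruct n as [|n]; [lia|].
assert (N1 : 1 <= IZR N) by now apply IZR_le.
pose proof (farey_spread_sum n) as S1.
pose proof (small_den_sum_bound (S n) Hn) as S2.
pose proof farey_start_gap as S3; pose proof farey_start_lt.
pose proof (farey_le 1 (S n) Hn).
assert (W : 0 <= small_den_weight (S n)).
{ unfold small_den_weight; destruct Z_le_dec; [|lra].
  left; apply Rinv_0_lt_compat; pose proof (farey_den_pos (S n)); lra. }
assert (P : 0 < 8 / (7 * IZR N)) by (apply Rdiv_lt_0_compat; lra).
assert (K : 8 / (7 * IZR N) * (2 * small_den_sum (S n) - small_den_weight (S n)) <=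
  16 / 7 * / (Q * IZR N) + 3 / 7 * (fr (S n) - w)).
{ apply Rle_trans with (8 / (7 * IZR N) * (2 * (/ Q + 3 * IZR N / 16 * (fr (S n) - w)))).
  - apply Rmult_le_compat_l; lra.
  - right; field; lra. }
assert (E : 0 < / (Q * IZR N)) by (apply Rinv_0_lt_compat; nra).
assert (E' : 0 < / IZR N ^ 2) by (apply Rinv_0_lt_compat; nra).
rewrite S_INR; pose proof (pos_INR n). unfold Rdiv in *. nra.
Qed.

End FareySpread.

(** * Convex functions through lattice points with Farey tangents *)

Lemma is_derive_glue (f1 f2 g1 g2 : R -> R) (c : R) :
  (forall x, is_derive f1 x (g1 x)) -> (forall x, is_derive f2 x (g2 x)) ->
  f1 c = f2 c -> g1 c = g2 c ->
  forall x, is_derive (fun x => if Rle_dec x c then f1 x else f2 x) x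
                      (if Rle_dec x c then g1 x else g2 x).
Proof.
intros H1 H2 Ef Eg x.
apply is_derive_Reals; intros eps Heps.
destruct (proj1 (is_derive_Reals _ _ _) (H1 x) eps Heps) as [d1 D1].
destruct (proj1 (is_derive_Reals _ _ _) (H2 x) eps Heps) as [d2 D2].
pose proof (cond_pos d1); pose proof (cond_pos d2).
destruct (Rtotal_order x c) as [L|[->|L]].
- assert (P : 0 < Rmin d1 (c - x)) by (apply Rmin_glb_lt; lra).
  exists (mkposreal _ P); intros h Hh Hd; simpl in Hd.
  pose proof (Rmin_l d1 (c - x)); pose proof (Rmin_r d1 (c - x)).
  assert (h < c - x) by (pose proof (Rle_abs h); lra).
  destruct (Rle_dec x c) as [_|]; [|lra]; destruct (Rle_dec (x + h) c) as [_|]; [|lra].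
  apply D1; lra.
- assert (P : 0 < Rmin d1 d2) by (apply Rmin_glb_lt; lra).
  exists (mkposreal _ P); intros h Hh Hd; simpl in Hd.
  pose proof (Rmin_l d1 d2); pose proof (Rmin_r d1 d2).
  destruct (Rle_dec c c) as [_|]; [|lra]; destruct (Rle_dec (c + h) c) as [_|].
  + apply D1; lra.
  + rewrite Ef, Eg; apply D2; lra.
- assert (P : 0 < Rmin d2 (x - c)) by (apply Rmin_glb_lt; lra).
  exists (mkposreal _ P); intros h Hh Hd; simpl in Hd.
  pose proof (Rmin_l d2 (x - c)); pose proof (Rmin_r d2 (x - c)).
  assert (- h < x - c) by (pose proof (Rle_abs (- h)); rewrite Rabs_Ropp in *; lra).
  destruct (Rle_dec x c) as [|_]; [lra|]; destruct (Rle_dec (x + h) c) as [|_]; [lra|].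
  apply D2; lra.
Qed.

(* With u = (x - x0) / X, the second derivative is G + u (1 - u) (A + B (1 - 2 u)):
   it equals G at both ends, A adjusts the total turning and B the chord direction. *)
Lemma arc_exists (G X s0 D Y x0 y0 : R) : 0 < X ->
  exists f g h : R -> R,
    (forall x, is_derive f x (g x)) /\ (forall x, is_derive g x (h x)) /\
    f x0 = y0 /\ g x0 = s0 /\ h x0 = G /\
    f (x0 + X) = y0 + Y /\ g (x0 + X) = s0 + D /\ h (x0 + X) = G /\
    forall x, x0 <= x <= x0 + X ->
      Rabs (h x - G) <=
        (6 * Rabs (D / X - G) + 60 * Rabs ((Y - s0 * X) / X ^ 2 - D / (2 * X))) / 4.
Proof.
intros HX.
set (A := 6 * (D / X - G)).
set (B := 60 * ((Y - s0 * X) / X ^ 2 - D / (2 * X))).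
pose (u := fun x => (x - x0) / X).
exists (fun x => y0 + s0 * (x - x0) + X ^ 2 * (G * u x ^ 2 / 2 +
  A * (u x ^ 3 / 6 - u x ^ 4 / 12) + B * (u x ^ 3 / 6 - u x ^ 4 / 4 + u x ^ 5 / 10))).
exists (fun x => s0 + X * (G * u x + A * (u x ^ 2 / 2 - u x ^ 3 / 3) +
  B * (u x ^ 2 / 2 - u x ^ 3 + u x ^ 4 / 2))).
exists (fun x => G + u x * (1 - u x) * (A + B * (1 - 2 * u x))).
assert (U0 : u x0 = 0) by (unfold u; field; lra).
assert (U1 : u (x0 + X) = 1) by (unfold u; field; lra).
split; [|split; [|split; [|split; [|split; [|split; [|split; [|split]]]]]]].
- intros x; unfold u; auto_derive; [trivial|]. field; lra.
- intros x; unfold u; auto_derive; [trivial|]. field; lra.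
- rewrite U0; field.
- rewrite U0; field.
- rewrite U0; field.
- rewrite U1; unfold A, B; field; lra.
- rewrite U1; unfold A, B; field; lra.
- rewrite U1; field.
- intros x Hx.
  assert (V : 0 <= u x <= 1).
  { unfold u; split; apply Rmult_le_reg_r with X; try lra; field_simplify; lra. }
  set (v := u x) in *; clearbody v.
  replace (G + v * (1 - v) * (A + B * (1 - 2 * v)) - G)
    with (v * (1 - v) * (A + B * (1 - 2 * v))) by ring.
  rewrite Rabs_mult, (Rabs_pos_eq (v * (1 - v))) by nra.
  assert (EA : 6 * Rabs (D / X - G) = Rabs A).
  { unfold A; rewrite Rabs_mult, (Rabs_pos_eq 6); lra. }
  assert (EB : 60 * Rabs ((Y - s0 * X) / X ^ 2 - D / (2 * X)) = Rabs B).
  { unfold B; rewrite Rabs_mult, (Rabs_pos_eq 60); lra. }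
  rewrite EA, EB.
  assert (K : Rabs (A + B * (1 - 2 * v)) <= Rabs A + Rabs B).
  { apply Rle_trans with (Rabs A + Rabs (B * (1 - 2 * v))); [apply Rabs_triang|].
    rewrite Rabs_mult.
    assert (Rabs (1 - 2 * v) <= 1) by (apply Rabs_le; lra).
    pose proof (Rabs_pos B); nra. }
  assert (v * (1 - v) <= 1 / 4) by (pose proof (pow2_ge_0 (v - 1 / 2)); lra).
  assert (0 <= v * (1 - v)) by nra.
  pose proof (Rabs_pos (A + B * (1 - 2 * v))). nra.
Qed.

(** Every arc has second derivative [G] at both ends, so the glued slope is differentiable at the
    knots. The bound [3 * G], divided by 4 in [arc_exists], limits the deviation from [G]. Left of
    [X O] the function is a parabola, and [e] is the length of this run-up. *)
Lemma spline_exists (G e : R) (X Y s : nat -> R) :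
  0 < G -> 0 <= e ->
  (forall i, X i < X (S i)) ->
  (forall i, 6 * Rabs ((s (S i) - s i) / (X (S i) - X i) - G) +
     60 * Rabs ((Y (S i) - Y i - s i * (X (S i) - X i)) / (X (S i) - X i) ^ 2 -
                (s (S i) - s i) / (2 * (X (S i) - X i))) <= 3 * G) ->
  forall n, exists f g h : R -> R,
    (forall x, is_derive f x (g x)) /\ (forall x, is_derive g x (h x)) /\
    g (X O - e) = s O - G * e /\
    (forall i, (i <= n)%nat -> f (X i) = Y i) /\
    g (X n) = s n /\ h (X n) = G /\
    forall x, X O - e <= x <= X n -> G / 4 <= h x <= 7 * G / 4.
Proof.
intros HG He HX HB.
assert (Mono : forall i j, (i <= j)%nat -> X i <= X j).
{ induction 1 as [|j Hj IH]; [lra|]. pose proof (HX j); lra. }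
induction n as [|n IH].
- exists (fun x => Y O + s O * (x - X O) + G * (x - X O) ^ 2 / 2),
    (fun x => s O + G * (x - X O)), (fun _ => G).
  split; [|split; [|split; [|split; [|split; [|split]]]]].
  + intros x; auto_derive; [trivial|]; field.
  + intros x; auto_derive; [trivial|]; field.
  + ring.
  + intros i Hi; replace i with O by lia; field.
  + ring.
  + ring.
  + intros; lra.
- destruct IH as (f & g & h & Df & Dg & Hg0 & Hf & Hg & Hh & Hb).
  pose proof (HX n) as HXn.
  destruct (arc_exists G (X (S n) - X n) (s n) (s (S n) - s n) (Y (S n) - Y n) (X n) (Y n)
    ltac:(lra)) as (f' & g' & h' & Df' & Dg' & E1 & E2 & E3 & E4 & E5 & E6 & E7).
  replace (X n + (X (S n) - X n)) with (X (S n)) in * by ring.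
  exists (fun x => if Rle_dec x (X n) then f x else f' x),
    (fun x => if Rle_dec x (X n) then g x else g' x),
    (fun x => if Rle_dec x (X n) then h x else h' x).
  split; [|split; [|split; [|split; [|split; [|split]]]]].
  + apply is_derive_glue; auto. rewrite E1; now apply Hf. now rewrite Hg.
  + apply is_derive_glue; auto. now rewrite Hg. now rewrite Hh.
  + pose proof (Mono O n ltac:(lia)); destruct Rle_dec; [exact Hg0|lra].
  + intros i Hi; destruct (Nat.eq_dec i (S n)) as [->|Ne].
    * destruct Rle_dec; [lra|]. rewrite E4; ring.
    * pose proof (Mono i n ltac:(lia)); destruct Rle_dec; [apply Hf; lia|lra].
  + destruct Rle_dec; [lra|]. rewrite E5; ring.
  + destruct Rle_dec; [lra|]. exact E6.
  + intros x Hx; destruct Rle_dec as [L|L]; [apply Hb; lra|].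
    pose proof (E7 x ltac:(lra)) as K; pose proof (HB n) as K'.
    assert (K2 : Rabs (h' x - G) <= 3 * G / 4) by lra.
    apply Rabs_le_between in K2. lra.
Qed.

(* Both al q and be q' lie in [Z, 1.1 Z] for Z = T / (2 q q'): this balance is what keeps the
   chord slope near the middle of the two tangent slopes. *)
Lemma balanced_chord_bound (T q q' a a' al be : R) :
  0 < q -> 0 < q' -> a' * q - a * q' = 1 ->
  10 <= T / (2 * q ^ 2 * q') -> 10 <= T / (2 * q * q' ^ 2) ->
  T / (2 * q ^ 2 * q') <= al <= T / (2 * q ^ 2 * q') + 1 ->
  T / (2 * q * q' ^ 2) <= be <= T / (2 * q * q' ^ 2) + 1 ->
  let X := al * q + be * q' in let Y := al * a + be * a' in
  let D := a' / q' - a / q in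
  (0 < X <= 11 / 10 * T * D) /\
  6 * Rabs (D / X - / T) + 60 * Rabs ((Y - a / q * X) / X ^ 2 - D / (2 * X)) <= 3 * / T.
Proof.
intros Hq Hq' Hd H1 H2 Hal Hbe X Y D.
set (Z := T / (2 * q * q')).
assert (E1 : T / (2 * q ^ 2 * q') * q = Z) by (unfold Z; field; lra).
assert (E2 : T / (2 * q * q' ^ 2) * q' = Z) by (unfold Z; field; lra).
assert (M : Z <= al * q <= 11 / 10 * Z) by (rewrite <- E1; nra).
assert (P : Z <= be * q' <= 11 / 10 * Z) by (rewrite <- E2; nra).
assert (HZ : 0 < Z) by (rewrite <- E1; nra).
assert (ET : T = 2 * Z * q * q') by (unfold Z; field; lra).
clearbody Z.
assert (HT : 0 < T) by (rewrite ET; repeat apply Rmult_lt_0_compat; lra).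
assert (ED : D = / (q * q')).
{ unfold D; apply Rmult_eq_reg_r with (q * q'); [|nra]. field_simplify; lra. }
(* The part of the chord along (q, a) follows the initial tangent, so only [be] contributes to the
   height above it. *)
assert (EY : Y - a / q * X = be * q' * / (q * q')).
{ unfold Y, X. replace be with (be * (a' * q - a * q')) at 3 by (rewrite Hd; ring). field; lra. }
assert (QQ : 0 < q * q') by nra.
assert (XE : X = al * q + be * q') by reflexivity. clearbody X D Y.
set (m := al * q) in *; set (p := be * q') in *; clearbody m p.
split.
- split; [lra|]. rewrite XE, ED, ET.
  replace (11 / 10 * (2 * Z * q * q') * / (q * q')) with (11 / 10 * 2 * Z) by (field; lra). lra.
- assert (HX : 2 * Z <= X <= 22 / 10 * Z) by lra.
  assert (EA : D / X - / T = / T * ((2 * Z - X) / X)) by (rewrite ED, ET; field; lra).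
  assert (EB : (Y - a / q * X) / X ^ 2 - D / (2 * X) = / T * ((p - m) * Z / X ^ 2)).
  { rewrite EY, ED, ET, XE; field; repeat split; lra. }
  rewrite EA, EB, !Rabs_mult.
  (* The two errors, relative to 1 / T, are at most 1/10 for the turning and 1/40 for the imbalance,
     and 6/10 + 60/40 is below 3. *)
  assert (IT : 0 < / T) by now apply Rinv_0_lt_compat.
  rewrite !(Rabs_pos_eq (/ T)) by lra.
  assert (A1 : Rabs ((2 * Z - X) / X) <= 1 / 10).
  { apply Rabs_le; split; apply Rmult_le_reg_r with X; try lra; field_simplify; lra. }
  assert (A2 : Rabs ((p - m) * Z / X ^ 2) <= 1 / 40).
  { apply Rabs_le; split; apply Rmult_le_reg_r with (X ^ 2); try nra; field_simplify; nra. }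
  nra.
Qed.

Fixpoint Zsum (u : nat -> Z) (n : nat) : Z :=
  match n with O => 0%Z | S m => (Zsum u m + u m)%Z end.

(** The lattice points are partial sums of balanced chords, starting at the origin. The bound on
    [N ^ 3] makes each unrounded coefficient at least 10, so rounding up costs at most a tenth:
    hence the factor 11/10. Index 0 is here the first fraction beyond [w]. *)
Lemma farey_curve_exists (T w : R) (N : Z) (a q : nat -> Z) (n : nat) :
  (1 <= N)%Z -> 20 * IZR N ^ 3 <= T ->
  (forall i, (1 <= q i <= N)%Z) ->
  (forall i, (a (S i) * q i - a i * q (S i) = 1)%Z) ->
  w < IZR (a O) / IZR (q O) ->
  exists (f g h : R -> R) (x0 : R) (X Y : nat -> Z),
    (forall x, is_derive f x (g x)) /\ (forall x, is_derive g x (h x)) /\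
    x0 < IZR (X O) /\ (forall i, (X i < X (S i))%Z) /\
    (forall i, (i <= n)%nat -> f (IZR (X i)) = IZR (Y i)) /\
    g x0 = w /\ g (IZR (X n)) = IZR (a n) / IZR (q n) /\
    IZR (X n) - x0 <= 11 / 10 * T * (IZR (a n) / IZR (q n) - w) /\
    forall x, x0 <= x <= IZR (X n) -> / T / 4 <= h x <= 7 * / T / 4.
Proof.
intros HN HT Hq Hd Hw.
assert (N1 : 1 <= IZR N) by now apply IZR_le.
assert (Tpos : 0 < T) by (assert (1 <= IZR N ^ 3) by (apply pow_R1_Rle; lra); lra).
assert (Q1 : forall i, 1 <= IZR (q i) <= IZR N) by (intros i; split; apply IZR_le, Hq).
assert (B : forall i j, 10 <= T / (2 * IZR (q i) ^ 2 * IZR (q j))).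
{ intros i j; destruct (Q1 i), (Q1 j).
  assert (1 <= IZR (q i) ^ 2 <= IZR N ^ 2) by (split; nra).
  assert (0 < IZR (q i) ^ 2 * IZR (q j) <= IZR N ^ 3) by (split; nra).
  apply Rmult_le_reg_r with (2 * IZR (q i) ^ 2 * IZR (q j)); [nra|].
  field_simplify; nra. }
pose (al := fun i => up (T / (2 * IZR (q i) ^ 2 * IZR (q (S i))))).
pose (be := fun i => up (T / (2 * IZR (q (S i)) ^ 2 * IZR (q i)))).
pose (X := Zsum (fun i => al i * q i + be i * q (S i))%Z).
pose (Y := Zsum (fun i => al i * a i + be i * a (S i))%Z).
pose (s := fun i => IZR (a i) / IZR (q i)).
assert (K : forall i, (0 < IZR (X (S i)) - IZR (X i) <= 11 / 10 * T * (s (S i) - s i)) /\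
  6 * Rabs ((s (S i) - s i) / (IZR (X (S i)) - IZR (X i)) - / T) +
  60 * Rabs ((IZR (Y (S i)) - IZR (Y i) - s i * (IZR (X (S i)) - IZR (X i))) /
             (IZR (X (S i)) - IZR (X i)) ^ 2 -
             (s (S i) - s i) / (2 * (IZR (X (S i)) - IZR (X i)))) <= 3 * / T).
{ intros i.
  assert (EX : IZR (X (S i)) - IZR (X i) = IZR (al i) * IZR (q i) + IZR (be i) * IZR (q (S i))).
  { unfold X; simpl; rewrite !plus_IZR, !mult_IZR; ring. }
  assert (EY : IZR (Y (S i)) - IZR (Y i) = IZR (al i) * IZR (a i) + IZR (be i) * IZR (a (S i))).
  { unfold Y; simpl; rewrite !plus_IZR, !mult_IZR; ring. }
  rewrite EX, EY. destruct (Q1 i), (Q1 (S i)).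
  pose proof (B i (S i)) as B1; pose proof (B (S i) i) as B2.
  destruct (archimed (T / (2 * IZR (q i) ^ 2 * IZR (q (S i))))) as [U1 U2].
  destruct (archimed (T / (2 * IZR (q (S i)) ^ 2 * IZR (q i)))) as [V1 V2].
  fold (al i) in U1, U2; fold (be i) in V1, V2.
  replace (2 * IZR (q (S i)) ^ 2 * IZR (q i)) with (2 * IZR (q i) * IZR (q (S i)) ^ 2) in * by ring.
  apply (balanced_chord_bound T); try lra.
  rewrite <- !mult_IZR, <- minus_IZR; f_equal; apply Hd. }
assert (X0 : IZR (X O) = 0) by reflexivity.
(* At the rate 1 / T, turning from slope [w] to [s O] takes this run-up. *)
set (e := T * (s O - w)).
assert (He : 0 < e) by (unfold e, s; apply Rmult_lt_0_compat; lra).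
destruct (spline_exists (/ T) e (fun i => IZR (X i)) (fun i => IZR (Y i)) s) with (n := n)
  as (f & g & h & Df & Dg & Hg0 & Hf & Hg & _ & Hb).
- now apply Rinv_0_lt_compat.
- lra.
- intros i; destruct (K i); lra.
- intros i; apply K.
- exists f, g, h, (IZR (X O) - e), X, Y.
  split; [exact Df|split; [exact Dg|]].
  split; [lra|].
  split; [intros i; apply lt_IZR; destruct (K i); lra|].
  split; [exact Hf|].
  split; [rewrite Hg0; unfold e; field; lra|].
  split; [exact Hg|].
  split; [|exact Hb].
  fold (s n); clear Hf Hg Hb.
  (* Each chord advances by at most 11/10 T times its turning, and the turnings telescope. *)
  induction n as [|n IH]; [unfold e in *; lra|].
  destruct (K n) as [[_ K1] _]. lra.
Qed.

(** * Counting lattice points on a graph *)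

Lemma In_Finite (U : Type) (L : list U) : Finite U (fun p => List.In p L).
Proof.
induction L as [|x L IH].
- apply Finite_downward_closed with (Empty_set U); [apply Empty_is_finite|].
  intros p [].
- apply Finite_downward_closed with (Add U (fun p => List.In p L) x); [now apply Add_preserves_Finite|].
  intros p [->|H]; [right; constructor|left; exact H].
Qed.

Lemma NoDup_cardinal (U : Type) (L : list U) : NoDup L -> cardinal U (fun p => List.In p L) (length L).
Proof.
induction 1 as [|x L Hx HL IH].
- replace (fun p => List.In p nil) with (Empty_set U); [apply card_empty|].
  apply Extensionality_Ensembles; split; intros p [].
- replace (fun p => List.In p (x :: L)) with (Add U (fun p => List.In p L) x).
  + now apply card_add.
  + apply Extensionality_Ensembles; split; intros p Hp.
    * destruct Hp as [p Hp|p Hp]; [now right|destruct Hp; now left].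
    * destruct Hp as [->|Hp]; [right; constructor|left; exact Hp].
Qed.

(** A graph has at most one lattice point over each integer abscissa, and the abscissae are
    bounded. *)
Lemma graph_lattice_points_finite (G : curve) (f : R -> R) :
  cx G = (fun t => t) -> cy G = f -> Finite (Z * Z) (lattice_points G).
Proof.
intros Ex Ey.
set (lo := up (c_start G)); set (hi := up (c_end G)).
(* [Int_part] supplies the only candidate ordinate. The list starts at [lo - 1] because [up] is
   strict and an integral [c_start] would be missed by [lo]. *)
apply Finite_downward_closed with (fun p => List.In p
  (map (fun k => let x := (lo - 1 + Z.of_nat k)%Z in (x, Int_part (f (IZR x))))
       (seq 0 (Z.to_nat (hi - lo + 2))))).
- apply In_Finite.
- intros [x y] (t & [H1 H2] & H3 & H4); simpl in H3, H4; rewrite Ex in H3; rewrite Ey in H4.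
  subst t; apply in_map_iff.
  destruct (archimed (c_start G)) as [A1 A2]; destruct (archimed (c_end G)) as [A3 A4].
  fold lo in A1, A2; fold hi in A3, A4.
  assert (L1 : (lo - 1 <= x)%Z) by (apply le_IZR; rewrite minus_IZR; lra).
  assert (L2 : (x < hi)%Z) by (apply lt_IZR; lra).
  exists (Z.to_nat (x - (lo - 1))); split.
  + cbv zeta; rewrite Z2Nat.id by lia.
    replace (lo - 1 + (x - (lo - 1)))%Z with x by ring.
    rewrite H4. f_equal.
    destruct (base_Int_part (IZR y)) as [P1 P2].
    apply le_IZR in P1.
    assert (y < Int_part (IZR y) + 1)%Z by (apply lt_IZR; rewrite plus_IZR; lra). lia.
  + apply in_seq; lia.
Qed.

Lemma graph_lattice_points_cardinal (G : curve) (f : R -> R) (X Y : nat -> Z) (n : nat) :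
  cx G = (fun t => t) -> cy G = f -> (forall i, (X i < X (S i))%Z) ->
  (forall i, (i < n)%nat -> c_dom G (IZR (X i)) /\ f (IZR (X i)) = IZR (Y i)) ->
  exists m, cardinal (Z * Z) (lattice_points G) m /\ (n <= m)%nat.
Proof.
intros Ex Ey HX HP.
destruct (finite_cardinal _ _ (graph_lattice_points_finite G f Ex Ey)) as [m Hm].
exists m; split; [exact Hm|].
assert (Mono : forall i j, (i < j)%nat -> (X i < X j)%Z).
{ induction 1 as [|j Hj IH]; [apply HX|]. specialize (HX j); lia. }
set (L := map (fun i => (X i, Y i)) (seq 0 n)).
replace n with (length L) by (unfold L; now rewrite length_map, length_seq).
refine (incl_card_le _ (fun p => List.In p L) _ _ _ (NoDup_cardinal _ _ _) Hm _).
- apply Injective_map_NoDup; [|apply seq_NoDup].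
  intros i j E; injection E as E _.
  destruct (Nat.lt_trichotomy i j) as [H|[H|H]]; [|exact H|]; apply Mono in H; lia.
- intros p Hp; apply in_map_iff in Hp; destruct Hp as (i & <- & Hi).
  apply in_seq in Hi; destruct (HP i ltac:(lia)) as [H1 H2].
  exists (IZR (X i)); rewrite Ex, Ey; auto.
Qed.

(** * From a convex graph to a curve: radius of curvature and length *)

Lemma is_derive_derivative_on (D : R -> Prop) (f df : R -> R) :
  (forall x, is_derive f x (df x)) -> derivative_on D f df.
Proof.
intros H t _ eps Heps.
destruct (proj2 (derivable_pt_lim_D_in f df t) (proj1 (is_derive_Reals _ _ _) (H t)) eps Heps)
  as (d & Hd & K).
exists d; split; [exact Hd|].
intros x [[_ Hx] Hx']; apply K; split; [split; [exact I|exact Hx]|exact Hx'].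
Qed.

Lemma is_derive_nonneg_le (g h : R -> R) (x y : R) : x <= y ->
  (forall t, is_derive g t (h t)) -> (forall t, x <= t <= y -> 0 <= h t) -> g x <= g y.
Proof.
intros Hxy Dg Hh.
destruct (MVT_gen g x y h) as (c & Hc & E).
- intros; apply Dg.
- intros; apply continuity_pt_filterlim, (ex_derive_continuous g); eexists; apply Dg.
- rewrite Rmin_left, Rmax_right in Hc by lra.
  specialize (Hh c Hc); nra.
Qed.

Lemma RInt_le_const (f : R -> R) (a b M : R) : a <= b ->
  (forall x, continuous f x) -> (forall x, a <= x <= b -> f x <= M) ->
  exists L, is_RInt f a b L /\ L <= M * (b - a).
Proof.
intros Hab Hc HM.
exists (RInt f a b); split.
- apply (RInt_correct f), (ex_RInt_continuous f); intros; apply Hc.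
- replace (M * (b - a)) with (RInt (fun _ => M) a b) by (rewrite RInt_const; unfold scal; simpl; unfold mult; simpl; ring).
  apply RInt_le; [exact Hab| | |].
  + apply (ex_RInt_continuous f); intros; apply Hc.
  + apply ex_RInt_const.
  + intros; apply HM; lra.
Qed.

(** The slope increases from [w] to at most 11/10, so the speed v is between 1 and 3/2. Hence the
    radius v^3 / h lies between 4 T / 7 and 27 T / 2. *)
Lemma graph_curve_exists (T w l : R) (f g h : R -> R) (x0 x1 : R) (X Y : nat -> Z) (n : nat) :
  0 < T -> x0 < x1 -> 0 <= w ->
  (forall x, is_derive f x (g x)) -> (forall x, is_derive g x (h x)) ->
  (forall x, x0 <= x <= x1 -> / T / 4 <= h x <= 7 * / T / 4) ->
  g x0 = w -> g x1 <= 11 / 10 -> 3 / 2 * (x1 - x0) < l ->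
  (forall i, (X i < X (S i))%Z) ->
  (forall i, (i < n)%nat -> x0 <= IZR (X i) <= x1 /\ f (IZR (X i)) = IZR (Y i)) ->
  exists (G : curve) (J : twice_differentiable G),
    (forall t, c_dom G t ->
       exists rho, is_radius_of_curvature J t rho /\ T / 32 <= rho <= 32 * T) /\
    (exists L, is_length J L /\ L < l) /\
    is_initial_slope J w /\
    (exists m : nat, cardinal (Z * Z) (lattice_points G) m /\ (n <= m)%nat).
Proof.
intros HT Hx Hw Df Dg Hh Hg0 Hg1 Hl HX HP.
pose (G := Curve (fun t => t) f x0 x1 Hx).
assert (J1 : derivative_on (c_dom G) (cx G) (fun _ => 1)).
{ apply is_derive_derivative_on; intros x; apply (is_derive_id (K := R_AbsRing) x). }
assert (J2 : derivative_on (c_dom G) (cy G) g) by now apply is_derive_derivative_on.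
assert (J3 : derivative_on (c_dom G) (fun _ => 1) (fun _ => 0)).
{ apply is_derive_derivative_on; intros x; apply (is_derive_const (K := R_AbsRing) 1 x). }
assert (J4 : derivative_on (c_dom G) g h) by now apply is_derive_derivative_on.
assert (J5 : forall t, c_dom G t -> 1 <> 0 \/ g t <> 0) by (intros; left; lra).
pose (J := TwiceDifferentiable G _ _ _ _ J1 J2 J3 J4 J5).
exists G, J.
assert (IT : 0 < / T) by now apply Rinv_0_lt_compat.
assert (Hg : forall t, x0 <= t <= x1 -> 0 <= g t <= 11 / 10).
{ intros t Ht; split.
  - rewrite <- Hg0 in Hw; apply Rle_trans with (g x0); [exact Hw|].
    apply is_derive_nonneg_le with h; [lra|exact Dg|]; intros u Hu.
    specialize (Hh u ltac:(lra)); lra.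
  - apply Rle_trans with (g x1); [|exact Hg1].
    apply is_derive_nonneg_le with h; [lra|exact Dg|]; intros u Hu.
    specialize (Hh u ltac:(lra)); lra. }
assert (Hsp : forall t, x0 <= t <= x1 -> 1 <= speed J t <= 3 / 2).
{ intros t Ht; specialize (Hg t Ht); unfold speed; simpl dx; simpl dy; split.
  - rewrite <- sqrt_1 at 1; apply sqrt_le_1_alt; nra.
  - rewrite <- (sqrt_pow2 (3 / 2)) by lra; apply sqrt_le_1_alt; nra. }
split; [|split; [|split]].
- intros t Ht; specialize (Hh t Ht); specialize (Hsp t Ht).
  unfold is_radius_of_curvature, curvature; simpl dx; simpl dy; simpl ddx; simpl ddy.
  replace (1 * h t - g t * 0) with (h t) by ring.
  rewrite Rabs_pos_eq by lra.
  set (v := speed J t) in *; clearbody v.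
  assert (V3 : 1 <= v ^ 3 <= 27 / 8) by (split; nra).
  exists (/ (h t / v ^ 3)); split; [split; [|reflexivity]|].
  + apply Rgt_not_eq, Rdiv_lt_0_compat; lra.
  + assert (E : T * / T = 1) by (apply Rinv_r; lra).
    replace (/ (h t / v ^ 3)) with (v ^ 3 / h t) by (field; split; lra).
    split; apply Rmult_le_reg_r with (h t); try lra;
      replace (v ^ 3 / h t * h t) with (v ^ 3) by (field; lra).
    * apply Rle_trans with 1; [|lra].
      apply Rle_trans with (T / 32 * (7 * / T / 4)); [apply Rmult_le_compat_l; lra|].
      replace (T / 32 * (7 * / T / 4)) with (T * / T * (7 / 128)) by (field; lra). lra.
    * apply Rle_trans with (27 / 8); [lra|].
      apply Rle_trans with (32 * T * (/ T / 4)); [|apply Rmult_le_compat_l; lra].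
      replace (32 * T * (/ T / 4)) with (T * / T * 8) by (field; lra). lra.
- destruct (RInt_le_const (speed J) x0 x1 (3 / 2)) as (L & H1 & H2).
  + lra.
  + intros x; apply (ex_derive_continuous (speed J)).
    unfold speed; simpl dx; simpl dy; auto_derive.
    pose proof (Dg x). split; [eexists; eassumption|]. split; [|trivial]. nra.
  + intros; now apply Hsp.
  + exists L; split; [exact H1|lra].
- split; simpl; [lra|]. rewrite Hg0; field.
- apply (graph_lattice_points_cardinal G f X Y); auto.
Qed.

(** * Choice of parameters *)

Theorem mainTheorem10 :
  exists C : R, 1 < C /\
  forall r l w : R,
    1 < r -> 1 < l ->
    800 * C ^ 2 * Rpower r (1 / 3) < l -> l < Rpower r (2 / 3) ->
    0 < w < 1 ->
    ~ (exists a q : Z,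
         (1 <= q)%Z /\
         IZR q <= 800 * C ^ 4 * Rpower r (2 / 3) / l /\
         Rabs (w - IZR a / IZR q) <= 1 / (IZR q * Rpower r (1 / 3))) ->
    exists (G : curve) (J : twice_differentiable G),
      (forall t, c_dom G t ->
         exists rho, is_radius_of_curvature J t rho /\
                     C ^ 3 * r / 32 <= rho <= 32 * C ^ 3 * r) /\
      (exists L, is_length J L /\ L < l) /\
      is_initial_slope J w /\
      (exists n : nat,
         cardinal (Z * Z) (lattice_points G) n /\
         1 / (3200 * PI ^ 2 * C) * (l * Rpower r (- (1 / 3))) <= INR n).
Proof.
exists 64; split; [lra|].
intros r l w Hr Hl Hl1 Hl2 Hw Hirr.
set (A := Rpower r (1 / 3)) in *.
assert (A1 : 1 < A).
{ pose proof (Rpower_lt r 0 (1 / 3) Hr ltac:(lra)) as H; rewrite Rpower_O in H by lra; exact H. }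
assert (EA2 : Rpower r (2 / 3) = A ^ 2).
{ unfold A; rewrite <- Rpower_pow by apply exp_pos.
  rewrite Rpower_mult; f_equal; simpl; field. }
assert (EA3 : r = A ^ 3).
{ unfold A; rewrite <- Rpower_pow by apply exp_pos.
  rewrite Rpower_mult; replace (1 / 3 * INR 3) with 1 by (simpl; field).
  now rewrite Rpower_1 by lra. }
rewrite (Rpower_Ropp r (1 / 3)); fold A.
rewrite EA2 in *; clearbody A.
set (Q := 800 * 64 ^ 4 * A ^ 2 / l) in *.
assert (HQ : 0 < Q) by (unfold Q; apply Rdiv_lt_0_compat; nra).
(* The divisor 3 gives 20 N^3 <= 20/27 T, while 64 A / 3 - 1 >= 16 A ensures A <= N / 16, as
   [farey_spread] requires. *)
set (N := Int_part (64 * A / 3)).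
destruct (base_Int_part (64 * A / 3)) as [N1 N2]; fold N in N1, N2.
assert (NA : 16 * A <= IZR N) by lra.
assert (HN : (1 <= N)%Z) by (apply le_IZR; lra).
set (T := 64 ^ 3 * A ^ 3).
assert (A3 : 1 <= A ^ 3) by (apply pow_R1_Rle; lra).
assert (HT : 0 < T) by (unfold T; lra).
assert (HNT : 20 * IZR N ^ 3 <= T).
{ assert (IZR N ^ 3 <= (64 * A / 3) ^ 3) by (apply pow_incr; lra). unfold T; lra. }
destruct (farey_seq N w HN) as (a & q & Hq & Hs & Hd & Hw0 & Hw1).
(* 28800 is 3200 * 9, with 9 as a lower bound for PI^2. The quantity rounded up exceeds 1 by the
   lower bound on [l], so [n] is less than twice it. *)
set (n := Z.to_nat (up (l / (28800 * 64 * A)))).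
destruct (archimed (l / (28800 * 64 * A))) as [U1 U2].
assert (L1 : 1 < l / (28800 * 64 * A)).
{ apply Rmult_lt_reg_r with (28800 * 64 * A); [lra|]. field_simplify; lra. }
assert (En : INR n = IZR (up (l / (28800 * 64 * A)))).
{ unfold n; rewrite INR_IZR_INZ, Z2Nat.id; [reflexivity|apply le_IZR; lra]. }
assert (Hn : (1 <= n)%nat) by (apply INR_le; simpl; lra).
assert (Hirr' : forall b d : Z, (1 <= d)%Z -> IZR d <= Q ->
  1 / (IZR d * A) < Rabs (w - IZR b / IZR d)).
{ intros b d H1 H2; apply Rnot_le_lt; intros H3; apply Hirr; now exists b, d. }
pose proof (farey_spread N w Q A a q HN Hq Hs Hd Hw0 Hw1 HQ ltac:(lra) Hirr' n Hn) as Hsp; cbv beta in Hsp.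
pose proof (farey_start_lt N w a q Hq Hw1 : w < IZR (a 1%nat) / IZR (q 1%nat)) as Hst.
set (dl := IZR (a n) / IZR (q n) - w) in *.
(* The two terms of the spread contribute about 0.031 [l] in all. The length is then at most 3/2 *
   11/10 * l / 25. *)
assert (HTd : T * dl <= l / 25).
{ apply Rle_trans with (T * (28 * INR n / IZR N ^ 2 + 8 / (Q * IZR N)));
    [apply Rmult_le_compat_l; lra|].
  assert (I1 : / IZR N ^ 2 <= / (256 * A ^ 2)) by (apply Rinv_le_contravar; nra).
  assert (I2 : / (Q * IZR N) <= / (Q * (16 * A))) by (apply Rinv_le_contravar; nra).
  apply Rle_trans with
    (T * (28 * (2 * (l / (28800 * 64 * A))) * / (256 * A ^ 2) + 8 * / (Q * (16 * A)))).
  - apply Rmult_le_compat_l; [lra|].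
    apply Rplus_le_compat; unfold Rdiv.
    + apply Rmult_le_compat; [lra| |lra|exact I1].
      left; apply Rinv_0_lt_compat; nra.
    + lra.
  - replace (T * (28 * (2 * (l / (28800 * 64 * A))) * / (256 * A ^ 2) + 8 * / (Q * (16 * A))))
      with (l * (28 * 2 * 16 / 28800 + 8 / (800 * 64 * 16))) by (unfold T, Q; field; lra).
    lra. }
(* Here l < A^2 is used: T dl is below A^2 / 25 and T = 64^3 A^3. So the final slope stays below
   11/10. *)
assert (Hdl : dl <= 1 / 10).
{ apply Rmult_le_reg_l with T; [exact HT|]. unfold T in *; nra. }
(* The sequence is shifted to start beyond [w]; its first [n] fractions give [n] lattice points
   joined by [n - 1] chords. *)
destruct (farey_curve_exists T w N (fun i => a (S i)) (fun i => q (S i)) (n - 1) HN HNT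
  (fun i => Hq (S i)) (fun i => Hd (S i)) Hst)
  as (f & g & h & x0 & X & Y & Df & Dg & Hx0 & HX & Hf & Hg0 & Hg1 & Hlen & Hh).
replace (S (n - 1)) with n in * by lia.
fold dl in Hlen.
assert (Mono : forall i j, (i <= j)%nat -> (X i <= X j)%Z).
{ induction 1 as [|j Hj IH]; [lia|]. specialize (HX j); lia. }
destruct (graph_curve_exists T w l f g h x0 (IZR (X (n - 1)%nat)) X Y n)
  as (G & J & HG1 & HG2 & HG3 & m & Hm & Hnm); auto; try lra.
- pose proof (IZR_le _ _ (Mono O (n - 1)%nat ltac:(lia))); lra.
- rewrite Hg1; unfold dl in *; lra.
- intros i Hi; split; [|apply Hf; lia].
  pose proof (IZR_le _ _ (Mono O i ltac:(lia))).
  pose proof (IZR_le _ _ (Mono i (n - 1)%nat ltac:(lia))). lra.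
- exists G, J; split; [|split; [exact HG2|split; [exact HG3|]]].
  + intros t Ht; rewrite EA3, (Rmult_assoc 32); apply HG1, Ht.
  + exists m; split; [exact Hm|].
    apply Rle_trans with (INR n); [|now apply le_INR].
    apply Rle_trans with (l / (28800 * 64 * A)); [|lra].
    assert (P : 9 <= PI ^ 2) by (pose proof PI2_3_2; nra).
    replace (1 / (3200 * PI ^ 2 * 64) * (l * / A)) with (l / (3200 * 64 * A) * / PI ^ 2)
      by (field; split; [lra|apply PI_neq0]).
    replace (l / (28800 * 64 * A)) with (l / (3200 * 64 * A) * / 9) by (field; lra).
    apply Rmult_le_compat_l; [|apply Rinv_le_contravar; lra].
    left; apply Rdiv_lt_0_compat; lra.
Qed.
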